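(* For $R=\mathbb{Z}_{25}$ and for $R=\mathbb{S}_5=\mathbb{F}_5[X]/(X^2)$ there exist projective arcs with parameters $(355,15)$, $(375,16)$ and $(395,17)$ in $\mathrm{PHG}(2,R)$.
   Context: For a finite chain ring $R$ of length $2$ with residue field $\mathbb{F}_q$, the projective Hjelmslev plane $\mathrm{PHG}(2,R)$ is the incidence structure whose points are the free rank-$1$ submodules of the right module $R_R^3$, whose lines are the free rank-$2$ submodules of $R_R^3$, with incidence given by inclusion. A projective $(k,n)$-arc is a set of $k$ points meeting every line in at most $n$ points. *)

(* Defs.v *)
From HB Require Import structures.
From mathcomp Require Import all_boot all_order all_algebra.
From mathcomp Require Import ring.
Set Implicit Arguments. Unset Strict Implicit. Unset Printing Implicit Defensive.
Import GRing.Theory.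
Local Open Scope ring_scope.

(* The ring S_5 = F_5[X]/(X^2), realised as pairs (a,b) <-> a + b X    *)
(* with (a,b)(c,d) = (ac, ad + bc).                                    *)
Definition S5 : Type := ('F_5 * 'F_5)%type.
HB.instance Definition _ := Finite.on S5.
HB.instance Definition _ := GRing.Zmodule.on S5.

Definition S5_one : S5 := (1, 0).
Definition S5_mul (x y : S5) : S5 := (x.1 * y.1, x.1 * y.2 + x.2 * y.1).
Definition S5_X : S5 := (0, 1).

Lemma S5_mulA : associative S5_mul.
Proof. by move=> [a b] [c d] [e f]; rewrite /S5_mul /=; congr pair; ring. Qed.
Lemma S5_mulC : commutative S5_mul.
Proof. by move=> [a b] [c d]; rewrite /S5_mul /=; congr pair; ring. Qed.
Lemma S5_mul1 : left_id S5_one S5_mul.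
Proof. by move=> [a b]; rewrite /S5_mul /= !mul1r mul0r addr0. Qed.
Lemma S5_mulDl : left_distributive S5_mul +%R.
Proof. by move=> [a b] [c d] [e f]; rewrite /S5_mul /=; congr pair; rewrite /=; ring. Qed.
Lemma S5_one_neq0 : S5_one != 0.
Proof. by []. Qed.

HB.instance Definition _ := GRing.Zmodule_isComNzRing.Build S5
  S5_mulA S5_mulC S5_mul1 S5_mulDl S5_one_neq0.

(* The projective Hjelmslev plane PHG(2,R) for a finite commutative   *)
(* ring R (for commutative R the right module R_R^3 is R^3 with       *)
(* scalar multiplication, written a *: x).                            *)
Section PHG.
Variable R : finComNzRingType.

(* a free rank-1 submodule of R^3: the image of an injective linear    *)
(* map R -> R^3, i.e. a |-> a *: x with this map injective             *)
Definition is_point (S : {set 'rV[R]_3}) : Prop :=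
  exists x : 'rV[R]_3,
    S = [set a *: x | a : R] /\ injective (fun a : R => a *: x).

(* a free rank-2 submodule of R^3: the image of an injective linear    *)
(* map R^2 -> R^3, i.e. (a,b) |-> a *: x + b *: y with this injective   *)
Definition is_line (S : {set 'rV[R]_3}) : Prop :=
  exists x y : 'rV[R]_3,
    S = [set ab.1 *: x + ab.2 *: y | ab : R * R] /\
    injective (fun ab : R * R => ab.1 *: x + ab.2 *: y).

Definition is_proj_arc (K : {set {set 'rV[R]_3}}) (k n : nat) : Prop :=
  [/\ (forall P, P \in K -> is_point P),
      #|K| = k &
      forall L, is_line L -> (#|[set P in K | P \subset L]| <= n)%N].

Definition proj_arc_exists (k n : nat) : Prop :=
  exists K : {set {set 'rV[R]_3}}, is_proj_arc K k n.
End PHG.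

(* Main.v *)
(** A finite chain ring R of length 2 with residue field F is an extension of F by
    its radical, a square-zero ideal isomorphic to F.  Reduction modulo the radical
    maps PHG(2,R) onto PG(2,F); the points over a point x of PG(2,F) form an affine
    plane AG(2,q), and the lines over a line d through x cut out one of its
    parallel classes, whose q segments are the level sets of the linear form d: each
    has an offset in F.

    The arcs are unions of such segments: over each x one takes the segments with
    offset in a set C(x) from the parallel class of a single line d(x) through x.
    A line over h contains no point over x unless h passes through x.  If it does
    and h <> d(x), the line meets each segment over x in exactly one point; if
    h = d(x), it contains one of the q segments of the class and misses the others,
    and the offset of that segment is given by a linear form over F.  Hence the size
    and the intersection numbers of the arc depend only on the data (d(x), C(x))
    over F, and the same data serve all chain rings R.  For F = F_5 the data were
    found by a computer search; the intersection numbers are verified by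
    evaluation. *)

From HB Require Import structures.
Require Import Defs.
From mathcomp Require Import all_boot all_order all_algebra.
From mathcomp Require Import ring.
Set Implicit Arguments. Unset Strict Implicit. Unset Printing Implicit Defensive.
Import GRing.Theory.
Local Open Scope ring_scope.

Reserved Notation "u *d v" (at level 40).
Reserved Notation "u *v v" (at level 40).

Definition dotmul (R : comNzRingType) (n : nat) (u v : 'rV[R]_n) : R :=
  (u *m v^T) 0 0.
Notation "u *d v" := (dotmul u v) : ring_scope.

Section DotProduct.
Variables (R : comNzRingType) (n : nat).
Implicit Types (u v w : 'rV[R]_n) (a : R).

Lemma dotmulE u v : u *d v = \sum_i u 0 i * v 0 i.
Proof. by rewrite /dotmul mxE; apply: eq_bigr => i _; rewrite mxE. Qed.

Lemma dotmulC u v : u *d v = v *d u.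
Proof. by rewrite !dotmulE; apply: eq_bigr => i _; rewrite mulrC. Qed.

Lemma dotmulDl u v w : (u + v) *d w = u *d w + v *d w.
Proof. by rewrite /dotmul mulmxDl mxE. Qed.

Lemma dotmulDr u v w : u *d (v + w) = u *d v + u *d w.
Proof. by rewrite /dotmul linearD mulmxDr mxE. Qed.

Lemma dotmulZl a u v : (a *: u) *d v = a * (u *d v).
Proof. by rewrite /dotmul -scalemxAl mxE. Qed.

Lemma dotmulZr a u v : u *d (a *: v) = a * (u *d v).
Proof. by rewrite dotmulC dotmulZl dotmulC. Qed.

Lemma dotmul_delta u i : u *d delta_mx 0 i = u 0 i.
Proof. by rewrite /dotmul trmx_delta -colE mxE. Qed.

Lemma dotmul_eq0 u v : (u *d v == 0) = (u *m v^T == 0).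
Proof.
apply/eqP/eqP=> [uv0|uv0]; last by rewrite /dotmul uv0 mxE.
by apply/matrixP=> i j; rewrite !ord1 [LHS]uv0 mxE.
Qed.

End DotProduct.

Lemma map_dotmul (aR rR : comNzRingType) (f : {rmorphism aR -> rR}) n
    (u v : 'rV[aR]_n) :
  f (u *d v) = map_mx f u *d map_mx f v.
Proof. by rewrite /dotmul map_trmx -map_mxM [RHS]mxE. Qed.

(* Coordinates are indexed by 'I_3 = Z/3, where one formula covers all three. *)
Definition crossmul (R : comNzRingType) (u v : 'rV[R]_3) : 'rV[R]_3 :=
  \row_k (u 0 (k + 1) * v 0 (k + 1 + 1) - u 0 (k + 1 + 1) * v 0 (k + 1)).
Notation "u *v v" := (crossmul u v) : ring_scope.

Section CrossProduct.
Variable R : comNzRingType.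
Implicit Types u v : 'rV[R]_3.

Lemma crossmulC u v : u *v v = - (v *v u).
Proof. by apply/rowP=> k; rewrite !mxE; ring. Qed.

Lemma dotmul_crossmull u v : u *d (u *v v) = 0.
Proof.
have ord3_addr111 (k : 'I_3) : k + 1 + 1 + 1 = k.
  by apply/val_inj; case: k => [[|[|[|//]]] ?].
rewrite dotmulE; under eq_bigr do rewrite mxE mulrBr.
rewrite sumrB [X in _ - X](reindex_inj (addIr 1)) /=; apply/eqP.
by rewrite subr_eq0; apply/eqP/eq_bigr=> k _; rewrite ord3_addr111; ring.
Qed.

Lemma dotmul_crossmulr u v : v *d (u *v v) = 0.
Proof. by rewrite crossmulC -scaleN1r dotmulZr dotmul_crossmull mulr0. Qed.

Lemma crossmul_eq0_minor u v i j :
  u *v v = 0 -> u 0 i * v 0 j = u 0 j * v 0 i.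
Proof.
move=> /rowP uv0.
have minor_next k : u 0 k * v 0 (k + 1) = u 0 (k + 1) * v 0 k.
  by have /eqP := uv0 (k - 1); rewrite !mxE subrK subr_eq0 => /eqP.
have : [\/ j = i, j = i + 1 | i = j + 1].
  move: i j => [[|[|[|//]]] i3] [[|[|[|//]]] j3];
    by [apply: Or31; apply: val_inj | apply: Or32; apply: val_inj
       | apply: Or33; apply: val_inj].
by case=> ->.
Qed.

End CrossProduct.

Lemma map_crossmul (aR rR : comNzRingType) (f : {rmorphism aR -> rR})
    (u v : 'rV[aR]_3) :
  map_mx f (u *v v) = map_mx f u *v map_mx f v.
Proof. by apply/rowP=> k; rewrite !mxE rmorphB !rmorphM. Qed.

Definition leading (V : nmodType) (s : seq V) : V := head 0 [seq a <- s | a != 0].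

Definition lead (V : nmodType) (n : nat) (u : 'rV[V]_n) : V :=
  leading (codom (u 0)).

Section Lead.
Variables (F : fieldType) (n : nat).
Implicit Types (a : F) (u v : 'rV[F]_n).

Lemma leadZ a u : lead (a *: u) = a * lead u.
Proof.
rewrite /lead /leading.
have -> : codom ((a *: u) 0) = [seq a * b | b <- codom (u 0)].
  by rewrite -map_comp; apply: eq_map => i; rewrite /= mxE.
elim: (codom _) => [|b s IHs] /=; first by rewrite mulr0.
have [a0|a0] := eqVneq a 0; first by move: IHs; rewrite a0 !mul0r eqxx.
by rewrite mulf_eq0 (negPf a0); case: (b == 0).
Qed.

Lemma lead_eq0 u : (lead u == 0) = (u == 0).
Proof.
rewrite /lead /leading.
have -> : (head 0 [seq a <- codom (u 0) | a != 0] == 0)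
    = all (pred1 0) (codom (u 0)).
  by elim: (codom _) => [|b s IHs] /=; [apply: eqxx | have [|/negPf] := eqVneq b 0].
apply/allP/eqP=> [u0|-> a /codomP[i ->]]; last by rewrite /= mxE.
by apply/rowP=> i; rewrite mxE; apply/eqP/u0/codom_f.
Qed.

Lemma lead1_neq0 u : lead u = 1 -> u != 0.
Proof. by rewrite -lead_eq0 => ->; apply: oner_neq0. Qed.

Lemma lead1_scale_eq a u v : lead u = 1 -> lead v = 1 -> v = a *: u -> v = u.
Proof. by move=> u1 v1 vE; rewrite vE -[a]mulr1 -u1 -leadZ -vE v1 scale1r. Qed.

End Lead.

Section ProjectivePlane.
Variable F : fieldType.
Implicit Types x d h y w z : 'rV[F]_3.

Lemma exists_plane_frame x d : x != 0 -> d != 0 -> x *d d = 0 ->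
  exists w z, [/\ w *d d = 1, z *d d = 0, forall s t, t *: z = s *: x -> t = 0 &
    forall y, exists s t, y = s *: x + t *: z + (y *d d) *: w].
Proof.
move=> x0 d0 /eqP xd; pose K := kermx d^T.
have inK y : (y <= K)%MS = (y *d d == 0) by rewrite sub_kermx dotmul_eq0.
have rankK : \rank K = 2 by rewrite mxrank_ker mxrank_tr rank_rV d0.
have [w wd] : exists w, w *d d = 1.
  have /rV0Pn[i di] := d0; exists ((d 0 i)^-1 *: delta_mx 0 i).
  by rewrite dotmulZl dotmulC dotmul_delta mulVf.
have [z zK zx] : exists2 z : 'rV_3, (z <= K)%MS & ~~ (z <= x)%MS.
  have /row_subPn[i zx] : ~~ (K <= x)%MS.
    by apply/negP=> /mxrankS; rewrite rankK rank_rV x0.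
  by exists (row i K); rewrite ?row_sub.
have Kxz : (K <= x + z)%MS.
  have xzK : (x + z <= K)%MS by rewrite addsmx_sub inK xd zK.
  rewrite -(mxrank_leqif_sup xzK) eqn_leq mxrankS // rankK.
  have /rank_ltmx : (x < x + z)%MS by rewrite ltmxE addsmxSl addsmx_sub submx_refl.
  by rewrite rank_rV x0.
exists w, z; split=> // [|s t tz|y]; first by apply/eqP; rewrite -inK.
  apply: contraNeq zx => t0; apply/sub_rVP; exists (t^-1 * s).
  by rewrite -scalerA -tz scalerA mulVf ?scale1r.
have : (y - (y *d d) *: w <= x + z)%MS.
  apply: submx_trans Kxz.
  by rewrite inK -scaleN1r dotmulDl !dotmulZl wd mulr1 mulN1r subrr.
case/sub_addsmxP=> -[a b] /= /eqP; rewrite subr_eq => /eqP yE.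
exists (a 0 0), (b 0 0).
by rewrite [a]mx11_scalar [b]mx11_scalar !mul_scalar_mx in yE.
Qed.

Lemma orthogonal_colinear x d h y :
    x != 0 -> d != 0 -> ~~ (h <= d)%MS ->
    x *d d = 0 -> x *d h = 0 -> y *d d = 0 -> y *d h = 0 ->
  exists s, y = s *: x.
Proof.
move=> x0 d0 hd xd xh yd; have [w [z [_ _ _ spanE]]] := exists_plane_frame x0 d0 xd.
have [s [t ->]] := spanE y.
rewrite yd scale0r addr0 dotmulDl !dotmulZl xh mulr0 add0r => /eqP.
rewrite mulf_eq0 => /orP[/eqP-> | /eqP zh]; first by exists s; rewrite scale0r addr0.
case/negP: hd; apply/sub_rVP; exists (w *d h); apply/rowP=> i.
rewrite mxE -!dotmul_delta [h *d _]dotmulC [d *d _]dotmulC.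
have [a [b uE]] := spanE (delta_mx 0 i).
by rewrite {1}uE !dotmulDl !dotmulZl xh zh !mulr0 !add0r mulrC.
Qed.

End ProjectivePlane.

Section Points.
Variables (R : finComNzRingType) (n : nat).

Definition point (v : 'rV[R]_n) : {set 'rV[R]_n} := [set a *: v | a : R].

Definition hyperplane (h : 'rV[R]_n) : {set 'rV[R]_n} := [set v | v *d h == 0].

Lemma mem_point (v : 'rV[R]_n) : v \in point v.
Proof. by apply/imsetP; exists 1; rewrite ?scale1r. Qed.

Lemma point_sub_hyperplane (v h : 'rV[R]_n) :
  (point v \subset hyperplane h) = (v *d h == 0).
Proof.
apply/subsetP/idP=> [/(_ v (mem_point v))|/eqP vh _ /imsetP[a _ ->]].
  by rewrite inE.
by rewrite inE dotmulZl vh mulr0.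
Qed.

End Points.

Section ArcData.
Variables (F : finFieldType) (I : finType).
Variables (x d : I -> 'rV[F]_3) (C : I -> {set F}).

(* The intersection number with the line whose equation reduces to h and has
   infinitesimal part eta.  It contains the segment with offset c over a point x with
   d(x) = h exactly if c = - <x, eta>. *)
Definition line_weight (h eta : 'rV[F]_3) : nat :=
  \sum_(i | x i *d h == 0)
    if d i == h then (#|F| * ((- (x i *d eta)) \in C i))%N else #|C i|.

Definition arc_data (k n : nat) : Prop :=
  [/\ injective x,
      forall i, [/\ lead (x i) = 1, lead (d i) = 1 & x i *d d i = 0],
      (#|F| * \sum_i #|C i|)%N = k &
      forall h eta, lead h = 1 -> (line_weight h eta <= n)%N].

End ArcData.

Lemma card_disjoint_bigcup (T I : finType) (A : I -> {set T}) :
    (forall i j, i != j -> [disjoint A i & A j]) ->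
  #|\bigcup_i A i| = (\sum_i #|A i|)%N.
Proof.
move=> disjA; rewrite -sum1_card partition_disjoint_bigcup //.
by apply: eq_bigr => i _; rewrite sum1_card.
Qed.

(* In a chain ring with radical pi R, rho is the reduction modulo pi, sigma a section
   of rho, and eps c is the product of pi with any lift of c. *)
Section SquareZeroExtension.
Variables (F : finFieldType) (R : finComNzRingType).
Variables (rho : {rmorphism R -> F}) (eps : {additive F -> R}) (sigma : F -> R).
Hypothesis sigmaK : cancel sigma rho.
Hypothesis eps_inj : injective eps.
Hypothesis ker_rho : forall r, rho r = 0 <-> exists c, r = eps c.
Hypothesis mul_eps : forall r c, r * eps c = eps (rho r * c).

Local Notation red := (map_mx rho).
Local Notation lift := (map_mx sigma).
Local Notation epsv := (map_mx eps).

Lemma rho_eps c : rho (eps c) = 0.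
Proof. by apply/ker_rho; exists c. Qed.

Section Vectors.
Variable n : nat.
Implicit Types (v w h : 'rV[R]_n) (x y : 'rV[F]_n).

Lemma red_lift x : red (lift x) = x.
Proof. by apply/rowP=> i; rewrite !mxE sigmaK. Qed.

Lemma red_epsv y : red (epsv y) = 0.
Proof. by apply/rowP=> i; rewrite !mxE rho_eps. Qed.

Lemma epsv_inj : injective (fun y : 'rV[F]_n => epsv y).
Proof.
by move=> y y' /rowP e; apply/rowP=> i; have := e i; rewrite !mxE => /eps_inj.
Qed.

Lemma scale_eps s v : eps s *: v = epsv (s *: red v).
Proof. by apply/rowP=> i; rewrite !mxE mulrC mul_eps mulrC. Qed.

Lemma red_translate v y : red (v + epsv y) = red v.
Proof. by rewrite map_mxD red_epsv addr0. Qed.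

Lemma eq_red_translate v w : red v = red w -> exists y, v = w + epsv y.
Proof.
move=> /rowP vw.
have /fin_all_exists[y yE] i : exists c, v 0 i = w 0 i + eps c.
  have /ker_rho[c cE] : rho (v 0 i - w 0 i) = 0.
    by apply/eqP; rewrite rmorphB subr_eq0; have := vw i; rewrite !mxE => ->.
  by exists c; rewrite -cE addrC subrK.
by exists (\row_i y i); apply/rowP=> i; rewrite !mxE.
Qed.

Lemma dotmul_epsvl y h : epsv y *d h = eps (y *d red h).
Proof.
rewrite !dotmulE raddf_sum; apply: eq_bigr => i _.
by rewrite !mxE mulrC mul_eps mulrC.
Qed.

Lemma dotmul_epsvr v y : v *d epsv y = eps (red v *d y).
Proof. by rewrite dotmulC dotmul_epsvl dotmulC. Qed.

Lemma dotmul_translate v y h :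
  (v + epsv y) *d h = v *d h + eps (y *d red h).
Proof. by rewrite dotmulDl dotmul_epsvl. Qed.

Lemma dotmul_translate_eq v y h :
  (v + epsv y) *d h = v *d h <-> y *d red h = 0.
Proof.
rewrite dotmul_translate; split=> [/eqP|->]; last by rewrite raddf0 addr0.
by rewrite -subr_eq0 addrC addKr raddf_eq0 // => /eqP.
Qed.

Lemma point_translate s v : point (v + epsv (s *: red v)) = point v.
Proof.
have sub a (u : 'rV_n) : point (u + epsv (a *: red u)) \subset point u.
  apply/subsetP=> _ /imsetP[b _ ->]; apply/imsetP; exists (b * (1 + eps a)) => //.
  by rewrite -scale_eps -{1}[u]scale1r -scalerDl scalerA.
apply/eqP; rewrite eqEsubset sub /=.
have {1}-> : v = v + epsv (s *: red v) + epsv (- s *: red (v + epsv (s *: red v))).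
  by rewrite red_translate scaleNr raddfN /= addrK.
exact: sub.
Qed.

Lemma eq_point_red v w : red v != 0 -> red w = red v -> point w = point v ->
  exists s, w = v + epsv (s *: red v).
Proof.
move=> v0 wv Pwv.
have := mem_point w; rewrite Pwv => /imsetP[a _ wE].
have /ker_rho[s sE] : rho (a - 1) = 0.
  have := wv; rewrite wE map_mxZ -[RHS]scale1r => /eqP.
  rewrite -subr_eq0 -scalerBl scaler_eq0 (negPf v0) orbF.
  by rewrite rmorphB rmorph1 => /eqP.
by exists s; rewrite -scale_eps -sE scalerBl scale1r addrC subrK.
Qed.

Lemma eq_point_lead v w :
  lead (red v) = 1 -> lead (red w) = 1 -> point v = point w -> red v = red w.
Proof.
move=> v1 w1 Pvw; have := mem_point v; rewrite Pvw => /imsetP[a _ vE].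
by apply: (@lead1_scale_eq _ _ (rho a)); rewrite // vE map_mxZ.
Qed.

Lemma scaler_red_inj v : red v != 0 -> injective (fun a : R => a *: v).
Proof.
move=> /rV0Pn[i]; rewrite mxE => vi a b /rowP/(_ i); rewrite !mxE => /eqP.
rewrite -subr_eq0 -mulrBl => /eqP abv; apply/eqP; rewrite -subr_eq0; apply/eqP.
have /ker_rho[c cE] : rho (a - b) = 0.
  by apply: (mulIf vi); rewrite -rmorphM abv rmorph0 mul0r.
move: abv; rewrite cE mulrC mul_eps => /eqP.
rewrite raddf_eq0 // mulf_eq0 (negPf vi) => /eqP->.
exact: raddf0.
Qed.

End Vectors.

Lemma is_point_red (v : 'rV[R]_3) : red v != 0 -> is_point (point v).
Proof. by move=> v0; exists v; split=> //; apply: scaler_red_inj. Qed.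

Lemma red_crossmul_neq0 (u v : 'rV[R]_3) :
    injective (fun ab : R * R => ab.1 *: u + ab.2 *: v) ->
  red (u *v v) != 0.
Proof.
move=> inj; rewrite map_crossmul; apply/eqP=> uv0.
have relation i : (eps (- red v 0 i), eps (red u 0 i)) = (0, 0).
  apply: inj; rewrite /= !scale_eps -raddfD !scale0r addr0.
  apply/rowP=> j; rewrite !mxE; apply/eqP; rewrite raddf_eq0 //.
  have := crossmul_eq0_minor i j uv0; rewrite !mxE => uvij.
  by rewrite mulNr uvij mulrC addNr.
suff : (eps 1, 0) = (0, 0) :> R * R.
  by case=> /eqP; rewrite raddf_eq0 // oner_eq0.
apply: inj; rewrite /= !scale0r !addr0 scale_eps scale1r.
apply/rowP=> i; have [_ ui] := relation i.
by rewrite [LHS]mxE ui mxE.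
Qed.

Lemma line_sub_hyperplane L : is_line L ->
  exists2 h : 'rV[R]_3, lead (red h) = 1 & L \subset hyperplane h.
Proof.
case=> u [v [-> /red_crossmul_neq0 uv0]]; set h := u *v v.
exists (sigma (lead (red h))^-1 *: h).
  by rewrite map_mxZ leadZ /= sigmaK mulVf ?lead_eq0.
apply/subsetP=> _ /imsetP[[a b] _ ->].
rewrite inE dotmulZr dotmulDl !dotmulZl.
by rewrite dotmul_crossmull dotmul_crossmulr !mulr0 addr0 mulr0.
Qed.

Implicit Types (x d eta : 'rV[F]_3) (h : 'rV[R]_3) (C : {set F}).

Definition fiber_chart x d (f : F * F -> 'rV[R]_3) : Prop :=
  [/\ forall ct, red (f ct) = x,
      forall ct, f ct *d lift d = eps ct.1,
      injective (fun ct => point (f ct)) &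
      forall v, red v = x -> exists ct, point v = point (f ct)].

Lemma exists_fiber_chart x d : x != 0 -> d != 0 -> x *d d = 0 ->
  exists f, fiber_chart x d f.
Proof.
move=> x0 d0 xd; have [w [z [wd zd z_indep spanE]]] := exists_plane_frame x0 d0 xd.
have [e eE] : exists e, lift x *d lift d = eps e.
  by apply/ker_rho; rewrite map_dotmul !red_lift.
pose f ct := lift x + epsv (ct.2 *: z + (ct.1 - e) *: w).
have fx ct : red (f ct) = x by rewrite red_translate red_lift.
have fd ct : f ct *d lift d = eps ct.1.
  rewrite dotmul_translate red_lift dotmulDl !dotmulZl zd wd eE -raddfD /=.
  by rewrite mulr0 mulr1 add0r addrC subrK.
exists f; split=> // [[c t] [c' t'] Pff | v vx].
  have [||s fE] := eq_point_red _ _ Pff; rewrite ?fx //; rewrite fx in fE.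
  have cc' : c = c'.
    apply: eps_inj; rewrite -[RHS](fd (c', t')) -[LHS](fd (c, t)) fE.
    by apply/dotmul_translate_eq; rewrite red_lift dotmulZl xd mulr0.
  congr pair => //; apply/eqP; rewrite -subr_eq0; apply/eqP/(z_indep s).
  move: fE; rewrite /f cc' -addrA -raddfD => /addrI/epsv_inj /=.
  by rewrite addrAC => /addIr tz; rewrite scalerBl tz addrAC subrr add0r.
have [y ->] : exists y, v = lift x + epsv y.
  by apply: eq_red_translate; rewrite red_lift.
have [s [t yE]] := spanE y; exists (y *d d + e, t).
rewrite -[RHS](point_translate s) fx /f -[in RHS]addrA -raddfD /= addrK {1}yE.
by rewrite -[s *: x + _ + _]addrA [s *: x + _]addrC.
Qed.

Definition segments (x d : 'rV[F]_3) (C : {set F}) : {set {set 'rV[R]_3}} :=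
  [set point v | v : 'rV[R]_3 & (red v == x) && (v *d lift d \in eps @: C)].

Lemma segmentsP x d C P :
  reflect (exists v c, [/\ red v = x, c \in C, v *d lift d = eps c & P = point v])
          (P \in segments x d C).
Proof.
apply: (iffP imsetP) => [[v]|[v [c [vx cC vd ->]]]].
  by rewrite inE => /andP[/eqP vx /imsetP[c cC vd]] ->; exists v, c.
by exists v => //; rewrite inE vx eqxx vd imset_f.
Qed.

Lemma segments_chartE x d C f : x != 0 -> x *d d = 0 -> fiber_chart x d f ->
  segments x d C = [set point (f ct) | ct in setX C setT].
Proof.
move=> x0 xd [fx fd _ f_surj]; apply/setP=> P; apply/segmentsP/imsetP.
  case=> v [c [vx cC vd ->]]; have [ct vf] := f_surj v vx; exists ct => //.
  rewrite !inE andbT; suff -> : ct.1 = c by [].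
  have [||s vE] := eq_point_red _ _ vf; rewrite ?vx ?fx //.
  apply: eps_inj; rewrite -fd -vd vE fx; apply/esym/dotmul_translate_eq.
  by rewrite red_lift dotmulZl xd mulr0.
by case=> ct; rewrite !inE andbT => ctC ->; exists (f ct), ct.1; split.
Qed.

Lemma card_segments x d C : x != 0 -> d != 0 -> x *d d = 0 ->
  #|segments x d C| = (#|F| * #|C|)%N.
Proof.
move=> x0 d0 xd; have [f chart_f] := exists_fiber_chart x0 d0 xd.
rewrite (segments_chartE C x0 xd chart_f); have [_ _ f_inj _] := chart_f.
by rewrite card_imset // cardsX cardsT mulnC.
Qed.

Lemma segments_disjoint x d C x' d' C' :
  lead x = 1 -> lead x' = 1 -> x != x' ->
  [disjoint segments x d C & segments x' d' C'].
Proof.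
move=> x1 x'1; apply: contraNT => /pred0Pn[P /andP[]].
move=> /segmentsP[v [_ [vx _ _ ->]]] /segmentsP[v' [_ [v'x' _ _ Pvv']]].
by rewrite -vx -v'x' (eq_point_lead _ _ Pvv') ?vx ?v'x'.
Qed.

Local Notation on_hyperplane S h := [set P in S | P \subset hyperplane h].

Lemma segments_hyperplane_disjoint x d C h : x *d red h != 0 ->
  on_hyperplane (segments x d C) h = set0.
Proof.
move=> xh; apply/setP=> P; rewrite !inE.
apply: contraNF xh => /andP[/segmentsP[v [_ [vx _ _ ->]]]].
by rewrite point_sub_hyperplane => /eqP vh; rewrite -vx -map_dotmul vh rmorph0.
Qed.

Lemma segments_hyperplane_parallel x d C eta :
    x != 0 -> d != 0 -> x *d d = 0 ->
  (#|on_hyperplane (segments x d C) (lift d + epsv eta)|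
     <= #|F| * ((- (x *d eta)) \in C))%N.
Proof.
move=> x0 d0 xd; set c0 := - (x *d eta).
have : on_hyperplane (segments x d C) (lift d + epsv eta)
         \subset segments x d (C :&: [set c0]).
  apply/subsetP=> _ /setIdP[/segmentsP[v [c [vx cC vd ->]]]].
  rewrite point_sub_hyperplane dotmulDr vd dotmul_epsvr vx -raddfD /=.
  rewrite raddf_eq0 // addr_eq0 => /eqP c_eq; apply/segmentsP.
  by exists v, c; split=> //; rewrite !inE cC c_eq eqxx.
move/subset_leq_card/leq_trans; apply.
rewrite card_segments // leq_mul2l; apply/orP; right.
have [c0C|c0C] := boolP (c0 \in C).
  by rewrite /= -(cards1 c0) subset_leq_card // subsetIr.
by rewrite leqn0 cards_eq0 setI_eq0 disjoint_sym disjoints1.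
Qed.

Lemma segments_hyperplane_transversal x d C h :
    x != 0 -> d != 0 -> x *d d = 0 -> ~~ (red h <= d)%MS ->
  (#|on_hyperplane (segments x d C) h| <= #|C|)%N.
Proof.
move=> x0 d0 xd hd; have [f chart_f] := exists_fiber_chart x0 d0 xd.
rewrite (segments_chartE C x0 xd chart_f); have [fx fd f_inj _] := chart_f.
pose A := [set ct in setX C [set: F] | f ct *d h == 0].
have sub : on_hyperplane [set point (f ct) | ct in setX C setT] h
             \subset [set point (f ct) | ct in A].
  apply/subsetP=> _ /setIdP[/imsetP[ct ctC ->]].
  by rewrite point_sub_hyperplane => fh; apply: imset_f; rewrite inE ctC.
have fst_inj : {in A &, injective fst}.
  move=> ct ct' /setIdP[_ /eqP fh] /setIdP[_ /eqP f'h] cc'; apply: f_inj.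
  have [y fE] : exists y, f ct = f ct' + epsv y by apply: eq_red_translate; rewrite !fx.
  have yd : y *d d = 0.
    by rewrite -(red_lift d); apply/(dotmul_translate_eq (f ct')); rewrite -fE !fd cc'.
  have yh : y *d red h = 0.
    by apply/(dotmul_translate_eq (f ct')); rewrite -fE fh f'h.
  have xh : x *d red h = 0 by rewrite -(fx ct) -map_dotmul fh rmorph0.
  have [s yE] := orthogonal_colinear x0 d0 hd xd xh yd yh.
  by rewrite fE yE -(fx ct') point_translate.
apply: leq_trans (subset_leq_card sub) _.
apply: leq_trans (leq_imset_card _ _) _.
rewrite -(card_in_imset fst_inj); apply/subset_leq_card/subsetP=> _ /imsetP[ct + ->].
by rewrite !inE andbT => /andP[].
Qed.

Section Arc.
Variables (I : finType) (x d : I -> 'rV[F]_3) (C : I -> {set F}).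
Hypothesis x_inj : injective x.
Hypothesis lead_x : forall i, lead (x i) = 1.
Hypothesis lead_d : forall i, lead (d i) = 1.
Hypothesis dotmul_xd : forall i, x i *d d i = 0.

Definition arc : {set {set 'rV[R]_3}} := \bigcup_i segments (x i) (d i) (C i).

Let x_neq0 i : x i != 0. Proof. exact: lead1_neq0. Qed.
Let d_neq0 i : d i != 0. Proof. exact: lead1_neq0. Qed.

Let disjoint_family i j : i != j ->
  [disjoint segments (x i) (d i) (C i) & segments (x j) (d j) (C j)].
Proof. by move=> ij; apply: segments_disjoint; rewrite ?(inj_eq x_inj). Qed.

Lemma is_point_arc P : P \in arc -> is_point P.
Proof.
by case/bigcupP=> i _ /segmentsP[v [_ [vx _ _ ->]]]; apply: is_point_red; rewrite vx.
Qed.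

Lemma card_arc : #|arc| = (#|F| * \sum_i #|C i|)%N.
Proof.
rewrite card_disjoint_bigcup // big_distrr.
by apply: eq_bigr => i _; apply: card_segments.
Qed.

Lemma card_arc_hyperplane h : lead (red h) = 1 ->
  exists eta, (#|on_hyperplane arc h| <= line_weight x d C (red h) eta)%N.
Proof.
move=> h1; have [eta hE] : exists eta, h = lift (red h) + epsv eta.
  by apply: eq_red_translate; rewrite red_lift.
exists eta; pose S i := on_hyperplane (segments (x i) (d i) (C i)) h.
have -> : on_hyperplane arc h = \bigcup_i S i.
  apply/setP=> P; apply/setIdP/bigcupP=> [[/bigcupP[i _ Pi] Ph]|[i _]].
    by exists i; rewrite ?inE ?Pi.
  by case/setIdP=> Pi Ph; split=> //; apply/bigcupP; exists i.
rewrite card_disjoint_bigcup => [|i j /disjoint_family]; last first.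
  by apply: disjointW; apply/subsetP=> P /setIdP[].
rewrite /line_weight [leqRHS]big_mkcond; apply: leq_sum => i _.
have [xh|xh] := eqVneq; last by rewrite /S segments_hyperplane_disjoint ?cards0.
have [dh|dh] := eqVneq (d i) (red h).
  by rewrite /S hE -dh; apply: segments_hyperplane_parallel.
apply: segments_hyperplane_transversal => //.
by apply: contra dh => /sub_rVP[a /lead1_scale_eq->].
Qed.

End Arc.

Lemma proj_arc_of_data (I : finType) (x d : I -> 'rV[F]_3) (C : I -> {set F}) k n :
  arc_data x d C k n -> proj_arc_exists R k n.
Proof.
case=> x_inj /all_and3[x1 d1 xd] sizeE weight_le.
exists (arc x d C); split=> [P||L]; first exact: is_point_arc.
  by rewrite card_arc.
case/line_sub_hyperplane=> h h1 Lh.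
have [eta] := card_arc_hyperplane C x_inj x1 d1 xd h1.
move=> /leq_trans/(_ (weight_le _ _ h1)); apply: leq_trans.
apply/subset_leq_card/subsetP=> P; rewrite !inE => /andP[-> PL].
exact: subset_trans PL Lh.
Qed.

End SquareZeroExtension.

Lemma ltn_Fp (p : nat) (c : 'F_p) : prime p -> (c < p)%N.
Proof. by move=> p_pr; have := ltn_ord c; rewrite [X in (_ < X)%N]Fp_cast. Qed.

Section ZpSquare.
Variable p : nat.
Hypothesis p_pr : prime p.

Definition Zp2_red (r : 'Z_(p ^ 2)) : 'F_p := (val r)%:R.
Definition Zp2_eps (c : 'F_p) : 'Z_(p ^ 2) := (p * val c)%:R.

Let psqr_gt1 : (1 < p ^ 2)%N.
Proof. by rewrite (ltn_exp2l 0) // prime_gt1. Qed.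

Lemma Zp2_red_natr m : Zp2_red m%:R = m%:R.
Proof.
rewrite /Zp2_red /= val_Zp_nat // -(Fp_nat_mod p_pr) modn_dvdm ?dvdn_exp //.
exact: Fp_nat_mod.
Qed.

Lemma Zp2_eps_natr m : Zp2_eps m%:R = (p * m)%:R.
Proof.
by rewrite /Zp2_eps /= val_Fp_nat // muln_modr -[(p * p)%N]/(p ^ 2)%N Zp_nat_mod.
Qed.

Fact Zp2_red_is_nmod_morphism : nmod_morphism Zp2_red.
Proof.
split=> [|r s]; first exact: (Zp2_red_natr 0).
by rewrite -[r]natr_Zp -[s]natr_Zp -natrD !Zp2_red_natr natrD.
Qed.

Fact Zp2_red_is_monoid_morphism : monoid_morphism Zp2_red.
Proof.
split=> [|r s]; first exact: (Zp2_red_natr 1).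
by rewrite -[r]natr_Zp -[s]natr_Zp -natrM !Zp2_red_natr natrM.
Qed.

Fact Zp2_eps_is_nmod_morphism : nmod_morphism Zp2_eps.
Proof.
split=> [|c e]; first by rewrite (Zp2_eps_natr 0) muln0.
by rewrite -[c]natr_Zp -[e]natr_Zp -natrD !Zp2_eps_natr mulnDr natrD.
Qed.

HB.instance Definition _ :=
  GRing.isNmodMorphism.Build _ _ Zp2_red Zp2_red_is_nmod_morphism.
HB.instance Definition _ :=
  GRing.isMonoidMorphism.Build _ _ Zp2_red Zp2_red_is_monoid_morphism.
HB.instance Definition _ :=
  GRing.isNmodMorphism.Build _ _ Zp2_eps Zp2_eps_is_nmod_morphism.

Lemma Zp2_eps_inj : injective Zp2_eps.
Proof.
move=> c e /(congr1 val); rewrite /= !val_Zp_nat // !modn_small.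
  by move/eqP; rewrite eqn_pmul2l ?prime_gt0 // => /eqP/val_inj.
all: by rewrite ltn_pmul2l ?prime_gt0 // ltn_Fp.
Qed.

Lemma ker_Zp2_red r : Zp2_red r = 0 <-> exists c, r = Zp2_eps c.
Proof.
split=> [/eqP|[c ->]]; last by rewrite /Zp2_eps Zp2_red_natr natrM pchar_Fp_0 ?mul0r.
rewrite -(dvdn_pcharf (pchar_Fp p_pr)) => /dvdnP[m rE]; exists m%:R.
by rewrite Zp2_eps_natr mulnC -rE natr_Zp.
Qed.

Lemma mul_Zp2_eps r c : r * Zp2_eps c = Zp2_eps (Zp2_red r * c).
Proof.
by rewrite -[r]natr_Zp -[c]natr_Zp Zp2_red_natr -natrM !Zp2_eps_natr -natrM mulnCA.
Qed.

Lemma proj_arc_Zp2 (I : finType) (x d : I -> 'rV['F_p]_3) C k n :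
  arc_data x d C k n -> proj_arc_exists 'Z_(p ^ 2) k n.
Proof.
apply: (@proj_arc_of_data _ _ Zp2_red Zp2_eps (fun a => (val a)%:R)).
- by move=> a; rewrite /= Zp2_red_natr natr_Zp.
- exact: Zp2_eps_inj.
- exact: ker_Zp2_red.
- exact: mul_Zp2_eps.
Qed.

End ZpSquare.

Definition S5_red (r : S5) : 'F_5 := r.1.
Definition S5_eps (c : 'F_5) : S5 := (0, c).

Fact S5_red_is_nmod_morphism : nmod_morphism S5_red.
Proof. by []. Qed.

Fact S5_red_is_monoid_morphism : monoid_morphism S5_red.
Proof. by []. Qed.

Fact S5_eps_is_nmod_morphism : nmod_morphism S5_eps.
Proof. by split=> // c e; congr pair; rewrite addr0. Qed.

HB.instance Definition _ :=
  GRing.isNmodMorphism.Build _ _ S5_red S5_red_is_nmod_morphism.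
HB.instance Definition _ :=
  GRing.isMonoidMorphism.Build _ _ S5_red S5_red_is_monoid_morphism.
HB.instance Definition _ :=
  GRing.isNmodMorphism.Build _ _ S5_eps S5_eps_is_nmod_morphism.

Lemma proj_arc_S5 (I : finType) (x d : I -> 'rV['F_5]_3) C k n :
  arc_data x d C k n -> proj_arc_exists S5 k n.
Proof.
apply: (@proj_arc_of_data _ _ S5_red S5_eps (fun a => (a, 0))).
- by [].
- by move=> c e [].
- move=> [a b]; split=> [/= a0|[c [-> _]] //]; exists b.
  by congr pair.
- by move=> [a b] c; congr pair; rewrite /= ?mulr0 ?addr0.
Qed.

Section DigitVectors.
Local Open Scope nat_scope.

Definition digit_vectors (p n : nat) : seq (seq nat) :=
  iter n (fun us => [seq a :: u | a <- iota 0 p, u <- us]) [:: [::]].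

Definition normal_digit_vectors (p n : nat) : seq (seq nat) :=
  [seq u <- digit_vectors p n | leading u == 1].

Definition dotn (n : nat) (u v : seq nat) : nat :=
  sumn [seq nth 0 u i * nth 0 v i | i <- index_iota 0 n].

Definition row_Fp (p n : nat) (u : seq nat) : 'rV['F_p]_n :=
  \row_i (nth 0 u i)%:R%R.

Lemma mem_digit_vectors p n u :
  (u \in digit_vectors p n) = (size u == n) && all (fun a => a < p) u.
Proof.
elim: n u => [|n IHn] u /=; first by rewrite inE -size_eq0; case: u.
apply/allpairsP/idP=> [[[a v] /= [ap + ->]]|].
  by rewrite IHn mem_iota /= in ap * => /andP[/eqP-> ->]; rewrite eqxx ap.
case: u => //= a u /andP[nu /andP[ap up]]; exists (a, u).
by rewrite IHn mem_iota up andbT.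
Qed.

Local Open Scope ring_scope.
Variables (p n : nat).
Hypothesis p_pr : prime p.
Implicit Types u v : seq nat.

Lemma natr_Fp_eq0 m : (m%:R == 0 :> 'F_p) = (p %| m)%N.
Proof. by rewrite -(dvdn_pcharf (pchar_Fp p_pr)). Qed.

Lemma natr_Fp_inj : {in gtn p &, injective (fun a => a%:R : 'F_p)}.
Proof.
move=> a b ap bp /(congr1 val); rewrite /= !val_Fp_nat //.
by rewrite !modn_small.
Qed.

Lemma dotmul_row_Fp u v : row_Fp p n u *d row_Fp p n v = (dotn n u v)%:R.
Proof.
rewrite dotmulE /dotn sumnE big_map big_mkord natr_sum.
by apply: eq_bigr => i _; rewrite !mxE natrM.
Qed.

Lemma row_Fp_inj : {in digit_vectors p n &, injective (row_Fp p n)}.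
Proof.
move=> u v; rewrite !mem_digit_vectors.
move=> /andP[/eqP nu /allP up] /andP[/eqP nv /allP vp] /rowP uv.
apply: (@eq_from_nth _ 0%N); rewrite ?nu ?nv // => i ni.
have := uv (Ordinal ni); rewrite !mxE; apply: natr_Fp_inj.
  by apply/up/mem_nth; rewrite nu.
by apply/vp/mem_nth; rewrite nv.
Qed.

Lemma row_Fp_surj (h : 'rV['F_p]_n) :
  exists2 u, u \in digit_vectors p n & h = row_Fp p n u.
Proof.
exists [seq val (h 0 i) | i : 'I_n].
  rewrite mem_digit_vectors size_map -cardE card_ord eqxx.
  by apply/allP=> _ /codomP[i ->]; apply: ltn_Fp.
apply/rowP=> i; rewrite mxE (nth_map i) ?size_enum_ord // nth_ord_enum.
by rewrite natr_Zp.
Qed.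

Lemma lead_row_Fp u : u \in digit_vectors p n -> lead (row_Fp p n u) = (leading u)%:R.
Proof.
rewrite mem_digit_vectors /lead => /andP[/eqP nu /allP up].
have -> : codom (row_Fp p n u 0) = [seq a%:R | a <- u].
  rewrite -[u in RHS](mkseq_nth 0%N) nu -map_comp /mkseq -val_enum_ord -map_comp.
  by apply: eq_map => i; rewrite /= mxE.
rewrite /leading filter_map (@eq_in_filter _ _ (fun a => a != 0%N)).
  by case: [seq a <- u | a != 0%N].
by move=> a /up ap; rewrite /= natr_Fp_eq0 /dvdn modn_small.
Qed.

Lemma lead_row_Fp_eq1 u : u \in digit_vectors p n ->
  (lead (row_Fp p n u) == 1) = (leading u == 1%N).
Proof.
move=> u_dig; rewrite lead_row_Fp //; apply/eqP/eqP=> [|->] //.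
move: u_dig; rewrite mem_digit_vectors => /andP[_ /allP up].
have lead_lt : (leading u < p)%N.
  rewrite /leading; case E : [seq a <- u | _] => [|a s] /=; first exact: prime_gt0.
  by apply: up; move: (mem_head a s); rewrite -E mem_filter => /andP[].
exact: (natr_Fp_inj lead_lt (prime_gt1 p_pr)).
Qed.

End DigitVectors.

Record segment_class :=
  SegmentClass { foot : seq nat; axis : seq nat; offsets : seq nat }.

Section DigitData.
Local Open Scope nat_scope.
Variable p : nat.
Implicit Types (ss : seq segment_class) (h eta : seq nat).

Definition digit_weight ss h eta : nat :=
  sumn [seq if axis s == h
            then p * has (fun c => p %| c + dotn 3 (foot s) eta) (offsets s)
            else size (offsets s)
       | s <- ss & p %| dotn 3 (foot s) h].

Definition wf_segment_class (s : segment_class) : bool :=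
  [&& foot s \in normal_digit_vectors p 3, axis s \in normal_digit_vectors p 3,
      p %| dotn 3 (foot s) (axis s), uniq (offsets s) & all (gtn p) (offsets s)].

Definition arc_check ss (k n : nat) : bool :=
  [&& uniq (map foot ss), all wf_segment_class ss,
      p * sumn [seq size (offsets s) | s <- ss] == k &
      all (fun h => all (fun eta => digit_weight ss h eta <= n) (digit_vectors p 3))
          (normal_digit_vectors p 3)].

Hypothesis p_pr : prime p.

Definition foot_vec s := row_Fp p 3 (foot s).
Definition axis_vec s := row_Fp p 3 (axis s).
Definition offset_set s : {set 'F_p} := [set:: [seq c%:R%R | c <- offsets s]].

Lemma lead_normal_row u : u \in normal_digit_vectors p 3 -> lead (row_Fp p 3 u) = 1%R.
Proof. by rewrite mem_filter => /andP[u1 udig]; apply/eqP; rewrite lead_row_Fp_eq1. Qed.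

Lemma card_offset_set s : wf_segment_class s -> #|offset_set s| = size (offsets s).
Proof.
case/and5P=> _ _ _ us /allP sp.
rewrite cardsE (card_uniqP _) ?size_map // map_inj_in_uniq //.
by move=> a b /sp ap /sp bp; apply: natr_Fp_inj.
Qed.

Lemma mem_opp_offset_set s m :
  ((- m%:R)%R \in offset_set s) = has (fun c => p %| c + m) (offsets s).
Proof.
rewrite inE; apply/mapP/hasP=> -[c cs] cE; exists c => //.
  by rewrite -natr_Fp_eq0 // natrD -cE addNr.
by apply/esym/eqP; rewrite -addr_eq0 -natrD natr_Fp_eq0.
Qed.

Section Family.
Variables (ss : seq segment_class) (k n : nat).
Let seg (i : 'I_(size ss)) := tnth (in_tuple ss) i.

Lemma line_weight_digits h eta : all wf_segment_class ss -> h \in digit_vectors p 3 ->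
  line_weight (foot_vec \o seg) (axis_vec \o seg) (offset_set \o seg)
    (row_Fp p 3 h) (row_Fp p 3 eta) = digit_weight ss h eta.
Proof.
move=> wf hdig; rewrite /line_weight /digit_weight sumnE big_map big_filter.
rewrite [RHS]big_tnth; apply: eq_big => [i|i _] /=.
  by rewrite dotmul_row_Fp natr_Fp_eq0.
have wfi := all_tnthP (wf : all _ (in_tuple ss)) i.
have [_ + _ _ _] := and5P wfi; rewrite mem_filter => /andP[_ axis_dig].
rewrite (inj_in_eq (@row_Fp_inj p 3 p_pr)) // card_Fp // card_offset_set //.
by rewrite dotmul_row_Fp mem_opp_offset_set.
Qed.

Lemma arc_data_of_check : arc_check ss k n ->
  arc_data (foot_vec \o seg) (axis_vec \o seg) (offset_set \o seg) k n.
Proof.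
case/and4P=> uniq_foot wf /eqP <- /allP weight_le.
have wf_seg := all_tnthP (wf : all _ (in_tuple ss)).
split=> [i j /row_Fp_inj ij|i||h eta].
- have /tuple_uniqP foot_inj : uniq (map_tuple foot (in_tuple ss)) by [].
  have foot_dig l : foot (seg l) \in digit_vectors p 3.
    by have [+ _ _ _ _] := and5P (wf_seg l); rewrite mem_filter => /andP[].
  by apply: foot_inj; rewrite !tnth_map; apply: ij.
- have [/lead_normal_row-> /lead_normal_row-> pxd _ _] := and5P (wf_seg i).
  by split=> //; apply/eqP; rewrite dotmul_row_Fp natr_Fp_eq0.
- rewrite card_Fp // sumnE big_map [in RHS]big_tnth; congr muln.
  by apply: eq_bigr => i _; apply: card_offset_set.
have [[u udig ->] [v vdig ->]] := (row_Fp_surj p_pr h, row_Fp_surj p_pr eta).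
move=> /eqP; rewrite lead_row_Fp_eq1 // => u1; rewrite line_weight_digits //.
by apply: (allP (weight_le u _)); rewrite // mem_filter u1.
Qed.

End Family.
End DigitData.

Section ArcFamilies.
Local Open Scope nat_scope.

Definition arc355 : seq segment_class := [::
  SegmentClass [:: 0; 0; 1] [:: 1; 0; 0] [:: 0; 1; 2];
  SegmentClass [:: 0; 1; 0] [:: 1; 0; 3] [:: 0];
  SegmentClass [:: 0; 1; 1] [:: 1; 3; 2] [:: 0; 1];
  SegmentClass [:: 0; 1; 2] [:: 1; 2; 4] [:: 0; 1];
  SegmentClass [:: 0; 1; 3] [:: 0; 1; 3] [:: 0; 1];
  SegmentClass [:: 0; 1; 4] [:: 1; 2; 2] [:: 0; 1; 2];
  SegmentClass [:: 1; 0; 0] [:: 0; 1; 3] [:: 0; 1];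
  SegmentClass [:: 1; 0; 1] [:: 1; 2; 4] [:: 0; 1];
  SegmentClass [:: 1; 0; 2] [:: 1; 3; 2] [:: 0; 1];
  SegmentClass [:: 1; 0; 3] [:: 1; 0; 3] [:: 0; 1; 2];
  SegmentClass [:: 1; 0; 4] [:: 1; 4; 1] [:: 0; 1; 2];
  SegmentClass [:: 1; 1; 0] [:: 0; 0; 1] [:: 0; 1; 2];
  SegmentClass [:: 1; 1; 1] [:: 1; 0; 4] [:: 0; 1; 2];
  SegmentClass [:: 1; 1; 2] [:: 1; 0; 2] [:: 0; 1; 2];
  SegmentClass [:: 1; 1; 4] [:: 1; 0; 1] [:: 0; 1; 2];
  SegmentClass [:: 1; 2; 0] [:: 1; 2; 4] [:: 0; 2];
  SegmentClass [:: 1; 2; 1] [:: 0; 1; 3] [:: 0; 2];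
  SegmentClass [:: 1; 2; 2] [:: 1; 3; 4] [:: 0; 1; 2];
  SegmentClass [:: 1; 2; 3] [:: 1; 0; 3] [:: 1; 3; 4];
  SegmentClass [:: 1; 2; 4] [:: 1; 3; 2] [:: 0; 2];
  SegmentClass [:: 1; 3; 0] [:: 1; 3; 2] [:: 2; 4];
  SegmentClass [:: 1; 3; 1] [:: 0; 1; 2] [:: 0; 1; 2];
  SegmentClass [:: 1; 3; 2] [:: 1; 2; 4] [:: 2; 4];
  SegmentClass [:: 1; 3; 3] [:: 1; 0; 3] [:: 0; 2; 3];
  SegmentClass [:: 1; 3; 4] [:: 0; 1; 3] [:: 2; 4];
  SegmentClass [:: 1; 4; 0] [:: 1; 1; 0] [:: 0; 1; 2];
  SegmentClass [:: 1; 4; 1] [:: 1; 3; 2] [:: 1; 3];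
  SegmentClass [:: 1; 4; 2] [:: 0; 1; 3] [:: 1; 3];
  SegmentClass [:: 1; 4; 3] [:: 1; 0; 3] [:: 4];
  SegmentClass [:: 1; 4; 4] [:: 1; 2; 4] [:: 1; 3]].

Definition arc375 : seq segment_class := [::
  SegmentClass [:: 0; 0; 1] [:: 1; 4; 0] [:: 0; 1];
  SegmentClass [:: 0; 1; 0] [:: 1; 0; 1] [:: 0; 1];
  SegmentClass [:: 0; 1; 1] [:: 1; 4; 1] [:: 0; 1; 2; 3];
  SegmentClass [:: 0; 1; 2] [:: 1; 1; 2] [:: 0; 1];
  SegmentClass [:: 0; 1; 3] [:: 1; 2; 1] [:: 0; 1; 2];
  SegmentClass [:: 0; 1; 4] [:: 1; 2; 2] [:: 0; 1; 2];
  SegmentClass [:: 1; 0; 0] [:: 0; 0; 1] [:: 0; 1; 2];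
  SegmentClass [:: 1; 0; 1] [:: 1; 2; 4] [:: 0; 1; 2];
  SegmentClass [:: 1; 0; 2] [:: 1; 1; 2] [:: 0; 1];
  SegmentClass [:: 1; 0; 3] [:: 0; 1; 0] [:: 0; 1; 2; 3];
  SegmentClass [:: 1; 0; 4] [:: 1; 0; 1] [:: 0];
  SegmentClass [:: 1; 1; 0] [:: 1; 4; 0] [:: 0; 1];
  SegmentClass [:: 1; 1; 1] [:: 1; 4; 0] [:: 0; 3];
  SegmentClass [:: 1; 1; 2] [:: 1; 4; 0] [:: 2; 3];
  SegmentClass [:: 1; 1; 3] [:: 1; 4; 0] [:: 1; 2];
  SegmentClass [:: 1; 2; 1] [:: 1; 1; 2] [:: 0; 2];
  SegmentClass [:: 1; 2; 2] [:: 1; 2; 0] [:: 0; 1; 2];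
  SegmentClass [:: 1; 2; 3] [:: 1; 2; 0] [:: 0; 1; 2];
  SegmentClass [:: 1; 2; 4] [:: 1; 0; 1] [:: 0; 1];
  SegmentClass [:: 1; 3; 0] [:: 0; 0; 1] [:: 0; 1; 2];
  SegmentClass [:: 1; 3; 1] [:: 1; 1; 1] [:: 0; 1; 2; 3];
  SegmentClass [:: 1; 3; 2] [:: 1; 2; 4] [:: 0; 1; 2];
  SegmentClass [:: 1; 3; 3] [:: 1; 1; 2] [:: 2; 4];
  SegmentClass [:: 1; 3; 4] [:: 1; 0; 1] [:: 1; 4];
  SegmentClass [:: 1; 4; 0] [:: 1; 1; 2] [:: 1; 3];
  SegmentClass [:: 1; 4; 1] [:: 1; 2; 1] [:: 0; 1; 2];
  SegmentClass [:: 1; 4; 2] [:: 1; 3; 1] [:: 0; 1; 2; 3];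
  SegmentClass [:: 1; 4; 3] [:: 1; 2; 2] [:: 0; 1; 2];
  SegmentClass [:: 1; 4; 4] [:: 1; 0; 1] [:: 3; 4]].

Definition arc395 : seq segment_class := [::
  SegmentClass [:: 0; 0; 1] [:: 1; 1; 0] [:: 0];
  SegmentClass [:: 0; 1; 0] [:: 1; 0; 1] [:: 0; 1];
  SegmentClass [:: 0; 1; 1] [:: 1; 0; 0] [:: 0; 1; 2];
  SegmentClass [:: 0; 1; 2] [:: 1; 3; 1] [:: 0; 1];
  SegmentClass [:: 0; 1; 3] [:: 1; 2; 1] [:: 0; 1];
  SegmentClass [:: 0; 1; 4] [:: 1; 0; 0] [:: 0; 1; 2];
  SegmentClass [:: 1; 0; 0] [:: 0; 1; 2] [:: 0; 1; 2];
  SegmentClass [:: 1; 0; 1] [:: 1; 4; 4] [:: 0; 1; 2; 3];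
  SegmentClass [:: 1; 0; 2] [:: 1; 0; 2] [:: 0; 1; 2; 3];
  SegmentClass [:: 1; 0; 3] [:: 1; 0; 3] [:: 0; 1; 2];
  SegmentClass [:: 1; 0; 4] [:: 1; 2; 1] [:: 0; 1];
  SegmentClass [:: 1; 1; 0] [:: 1; 4; 2] [:: 0; 1; 2; 3];
  SegmentClass [:: 1; 1; 1] [:: 1; 3; 1] [:: 0; 1; 3];
  SegmentClass [:: 1; 1; 2] [:: 1; 2; 1] [:: 0; 3];
  SegmentClass [:: 1; 1; 3] [:: 1; 0; 3] [:: 0; 1; 2];
  SegmentClass [:: 1; 1; 4] [:: 1; 0; 1] [:: 0; 1; 3];
  SegmentClass [:: 1; 2; 0] [:: 1; 2; 1] [:: 2; 3];
  SegmentClass [:: 1; 2; 1] [:: 1; 2; 0] [:: 0; 1; 2];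
  SegmentClass [:: 1; 2; 2] [:: 1; 2; 0] [:: 0; 1; 2];
  SegmentClass [:: 1; 2; 3] [:: 1; 3; 1] [:: 3; 4];
  SegmentClass [:: 1; 2; 4] [:: 1; 0; 1] [:: 3; 4];
  SegmentClass [:: 1; 3; 0] [:: 1; 3; 1] [:: 1; 2; 4];
  SegmentClass [:: 1; 3; 1] [:: 0; 1; 2] [:: 0; 1; 2];
  SegmentClass [:: 1; 3; 2] [:: 1; 2; 4] [:: 0; 1; 2; 3];
  SegmentClass [:: 1; 3; 3] [:: 1; 2; 1] [:: 1; 2];
  SegmentClass [:: 1; 3; 4] [:: 1; 0; 1] [:: 1; 2; 4];
  SegmentClass [:: 1; 4; 0] [:: 1; 1; 0] [:: 0; 1; 2];
  SegmentClass [:: 1; 4; 1] [:: 1; 1; 0] [:: 0; 1];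
  SegmentClass [:: 1; 4; 2] [:: 1; 3; 1] [:: 2];
  SegmentClass [:: 1; 4; 3] [:: 1; 1; 0] [:: 2];
  SegmentClass [:: 1; 4; 4] [:: 1; 0; 1] [:: 2]].

Lemma arc355_check : arc_check 5 arc355 355 15.
Proof. by vm_compute. Qed.

Lemma arc375_check : arc_check 5 arc375 375 16.
Proof. by vm_compute. Qed.

Lemma arc395_check : arc_check 5 arc395 395 17.
Proof. by vm_compute. Qed.

End ArcFamilies.

Lemma proj_arc_of_check (ss : seq segment_class) (k n : nat) :
  arc_check 5 ss k n -> proj_arc_exists 'Z_25 k n /\ proj_arc_exists S5 k n.
Proof.
move=> /(arc_data_of_check (erefl : prime 5)) data; split.
  exact: (proj_arc_Zp2 (erefl : prime 5) data).
exact: proj_arc_S5 data.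
Qed.

Theorem theorem3p9 :
  (proj_arc_exists 'Z_25 355 15 /\
   proj_arc_exists 'Z_25 375 16 /\
   proj_arc_exists 'Z_25 395 17) /\
  (proj_arc_exists S5 355 15 /\
   proj_arc_exists S5 375 16 /\
   proj_arc_exists S5 395 17).
Proof.
have [Z355 S355] := proj_arc_of_check arc355_check.
have [Z375 S375] := proj_arc_of_check arc375_check.
have [Z395 S395] := proj_arc_of_check arc395_check.
by [].
Qed.
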